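(* Let $\mathcal{A}$ and $\mathcal{B}$ be 2-torsion free rings such that each of them is either semiprime or satisfies Condition (P). Let $\mathcal{M}$ be a 2-torsion free faithful $(\mathcal{A},\mathcal{B})$-bimodule such that for every $m\in\mathcal{M}$: if $\mathcal{A}m=\{0\}$ then $m=0$, and if $m\mathcal{B}=\{0\}$ then $m=0$. Let $d:\mathcal{A}\to\mathcal{A}$ and $D:\mathcal{B}\to\mathcal{B}$ be two commuting Jordan derivations and let $\mathfrak{G}:\mathcal{M}\to\mathcal{M}$ be a mapping which satisfies $$\mathfrak{G}(am+mb)=2d(a)m+2\mathfrak{G}(m)b=2a\mathfrak{G}(m)+2mD(b)$$ for all $a\in\mathcal{A}$, $b\in\mathcal{B}$ and $m\in\mathcal{M}$. Then $d$, $D$ and $\mathfrak{G}$ are identically zero.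
   Context: Rings are associative and not assumed to be unital (nor commutative). A ring or module $X$ is 2-torsion free if $2x=0$ with $x\in X$ implies $x=0$. A ring $\mathcal{R}$ is semiprime if, for $a\in\mathcal{R}$, $a\mathcal{R}a=\{0\}$ implies $a=0$. A ring $\mathcal{R}$ satisfies Condition (P) if, for $a\in\mathcal{R}$, $xax=0$ for all $x\in\mathcal{R}$ implies $a=0$. An $(\mathcal{A},\mathcal{B})$-bimodule $\mathcal{M}$ is faithful if, for $a\in\mathcal{A}$, $a\mathcal{M}=\{0\}$ implies $a=0$, and, for $b\in\mathcal{B}$, $\mathcal{M}b=\{0\}$ implies $b=0$. A Jordan derivation on a ring $\mathcal{R}$ is an additive map $\Delta:\mathcal{R}\to\mathcal{R}$ with $\Delta(x^2)=\Delta(x)x+x\Delta(x)$ for all $x\in\mathcal{R}$; a map $\Delta:\mathcal{R}\to\mathcal{R}$ is commuting if $\Delta(x)x=x\Delta(x)$ for all $x\in\mathcal{R}$. *)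

(* Defs.v *)
From HB Require Import structures.
From mathcomp Require Import all_boot all_order all_algebra.

Set Implicit Arguments.
Unset Strict Implicit.
Unset Printing Implicit Defensive.

Import GRing.Theory.

Declare Scope rng_scope.
Local Open Scope ring_scope.

(* MathComp's [pzRingType] and [nzRingType] have a unit, and their modules are
   unital; hence the structures below, for associative rings without a unit
   and their bimodules, over [zmodType]. *)

HB.mixin Record Zmodule_isRng R of GRing.Zmodule R := {
  rng_mul : R -> R -> R;
  rng_mulA : associative rng_mul;
  rng_mulDl : left_distributive rng_mul +%R;
  rng_mulDr : right_distributive rng_mul +%R
}.

#[short(type="rngType")]
HB.structure Definition Rng := { R of Zmodule_isRng R & GRing.Zmodule R }.

Notation "x ** y" := (rng_mul x y) (at level 40, left associativity) : rng_scope.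
Local Open Scope rng_scope.

HB.mixin Record Zmodule_isBimodule (A B : rngType) M of GRing.Zmodule M := {
  bimod_l : A -> M -> M;
  bimod_r : M -> B -> M;
  bimod_lA : forall a a' m, bimod_l (a ** a') m = bimod_l a (bimod_l a' m);
  bimod_lDl : forall a a' m, bimod_l (a + a') m = bimod_l a m + bimod_l a' m;
  bimod_lDr : forall a m m', bimod_l a (m + m') = bimod_l a m + bimod_l a m';
  bimod_rA : forall m b b', bimod_r m (b ** b') = bimod_r (bimod_r m b) b';
  bimod_rDl : forall m m' b, bimod_r (m + m') b = bimod_r m b + bimod_r m' b;
  bimod_rDr : forall m b b', bimod_r m (b + b') = bimod_r m b + bimod_r m b';
  bimod_lr : forall a m b, bimod_r (bimod_l a m) b = bimod_l a (bimod_r m b)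
}.

#[short(type="bimodType")]
HB.structure Definition Bimodule (A B : rngType) :=
  { M of Zmodule_isBimodule A B M & GRing.Zmodule M }.

Notation "a *> m" := (bimod_l a m) (at level 40, left associativity) : rng_scope.
Notation "m <* b" := (bimod_r m b) (at level 40, left associativity) : rng_scope.

Definition torsion_free2 (X : zmodType) : Prop :=
  forall x : X, x *+ 2 = 0 -> x = 0.

Definition semiprime (R : rngType) : Prop :=
  forall a : R, (forall x : R, a ** x ** a = 0) -> a = 0.

Definition condition_P (R : rngType) : Prop :=
  forall a : R, (forall x : R, x ** a ** x = 0) -> a = 0.

Definition faithful_bimodule (A B : rngType) (M : bimodType A B) : Prop :=
  (forall a : A, (forall m : M, a *> m = 0) -> a = 0) /\
  (forall b : B, (forall m : M, m <* b = 0) -> b = 0).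

Definition jordan_derivation (R : rngType) (Delta : R -> R) : Prop :=
  {morph Delta : x y / x + y} /\
  (forall x : R, Delta (x ** x) = Delta x ** x + x ** Delta x).

Definition commuting_map (R : rngType) (Delta : R -> R) : Prop :=
  forall x : R, Delta x ** x = x ** Delta x.

(* Main.v *)
(* Since [D 0 = 0], the hypotheses give [G (a m) = 2 a G m]. Computing
   [G (a a' m)] with [a a'] acting at once, or with [a] and [a'] in succession,
   yields [2 a a' G m = 4 a a' G m], so [2 a a' G m = 0] and [a a' G m = 0]. As [M] has no nonzero
   element annihilated by [A], [G = 0]; then [d a m = a G m = 0] and
   [m D b = G m b = 0], and faithfulness finishes. *)

Require Import Defs.
From mathcomp Require Import all_boot all_order all_algebra.

Import GRing.Theory.

Local Open Scope ring_scope.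
Local Open Scope rng_scope.

Lemma bimod_l0 (A B : rngType) (M : bimodType A B) (a : A) :
  a *> (0 : M) = 0.
Proof. by apply: (addrI (a *> 0)); rewrite -bimod_lDr !addr0. Qed.

Lemma bimod_r0 (A B : rngType) (M : bimodType A B) (m : M) :
  m <* (0 : B) = 0.
Proof. by apply: (addrI (m <* 0)); rewrite -bimod_rDr !addr0. Qed.

Lemma bimod_0r (A B : rngType) (M : bimodType A B) (b : B) :
  (0 : M) <* b = 0.
Proof. by apply: (addrI (0 <* b)); rewrite -bimod_rDl !addr0. Qed.

Lemma jordan_derivation0 (R : rngType) (Delta : R -> R) :
  jordan_derivation Delta -> Delta 0 = 0.
Proof.
by case=> DeltaD _; apply: (addrI (Delta 0)); rewrite -DeltaD !addr0.
Qed.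

Theorem corollary2p9 (A B : rngType) (M : bimodType A B)
    (A_tf : torsion_free2 A) (B_tf : torsion_free2 B) (M_tf : torsion_free2 M)
    (A_sp : semiprime A \/ condition_P A)
    (B_sp : semiprime B \/ condition_P B)
    (M_faithful : faithful_bimodule M)
    (M_l : forall m : M, (forall a : A, a *> m = 0) -> m = 0)
    (M_r : forall m : M, (forall b : B, m <* b = 0) -> m = 0)
    (d : A -> A) (D : B -> B) (G : M -> M)
    (d_jordan : jordan_derivation d) (d_comm : commuting_map d)
    (D_jordan : jordan_derivation D) (D_comm : commuting_map D)
    (G_eql : forall (a : A) (b : B) (m : M),
       G (a *> m + m <* b) = (d a *> m) *+ 2 + (G m <* b) *+ 2)
    (G_eqr : forall (a : A) (b : B) (m : M),
       G (a *> m + m <* b) = (a *> G m) *+ 2 + (m <* D b) *+ 2) :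
  [/\ forall a : A, d a = 0, forall b : B, D b = 0 & forall m : M, G m = 0].
Proof.
have D0 := jordan_derivation0 _ _ D_jordan.
have G_act a m : G (a *> m) = (a *> G m) *+ 2.
  by have := G_eqr a 0 m; rewrite D0 !bimod_r0 mul0rn !addr0.
have G0 m : G m = 0.
  (* [M_l] strips one left factor at a time, so two uses reduce [G m = 0] to
     [a *> (a' *> G m) = 0]. *)
  apply: (M_l) => a'; apply: M_l => a; apply: M_tf.
  have : G ((a ** a') *> m) = G (a *> (a' *> m)) by rewrite bimod_lA.
  (* With [t := (a *> (a' *> G m)) *+ 2], the equation becomes [t = t + t]; cancelling [t] leaves
     [t = 0]. *)
  rewrite !G_act bimod_lA [_ *> G m *+ 2 in RHS]mulr2n bimod_lDr mulrnDl.
  by rewrite -[LHS]addr0 => /addrI.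
split=> //.
(* Only [G_eql] involves [d]; [b = 0] isolates its term. *)
- move=> a; apply: (proj1 M_faithful) => m; apply: M_tf.
  by have := G_eql a 0 m; rewrite !G0 bimod_0r mul0rn addr0.
(* Symmetrically, [a = 0] in [G_eqr] isolates [m <* D b]. *)
- move=> b; apply: (proj2 M_faithful) => m; apply: M_tf.
  by have := G_eqr 0 b m; rewrite !G0 bimod_l0 mul0rn add0r.
Qed.
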